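(* Let $V$ be a discrete vector space over a discrete field $\mathbb K$ and let $\phi\colon V\to V$ be an endomorphism. Then $$\mathrm{ent}(\phi)=\mathrm{ent}_{\dim}(\phi).$$
   Context: $\mathbb K$ is an arbitrary field endowed with the discrete topology. A topological vector space over $\mathbb K$ is linearly topologized if it is Hausdorff and has a neighborhood basis at $0$ consisting of linear subspaces. A linear variety of $V$ is a coset $v+W$ of a linear subspace $W$; it is closed (open) if $W$ is closed (open). A linearly topologized vector space is linearly compact if every collection of closed linear varieties with the finite intersection property has non-empty intersection. A linearly topologized vector space is locally linearly compact (l.l.c.) if it has an open linear subspace that is linearly compact (in particular discrete vector spaces are l.l.c.); $\mathcal B(V)$ denotes the family of all linearly compact open linear subspaces of $V$. ''Endomorphism'' means linear endomorphism. For a continuous endomorphism $\phi$ of an l.l.c. space $V$, a linear subspace $F$ and a positive integer $n$, let $T_n(\phi,F)=F+\phi F+\dots+\phi^{n-1}F$. For $U\in\mathcal B(V)$ define $H(\phi,U)=\lim_{n\to\infty}\frac1n\dim\frac{T_n(\phi,U)}{U}$ (the limit exists) and $\mathrm{ent}(\phi)=\sup\{H(\phi,U)\mid U\in\mathcal B(V)\}\in\mathbb N\cup\{\infty\}$. The dimension entropy of an endomorphism $\phi$ of a vector space $V$ is $\mathrm{ent}_{\dim}(\phi)=\sup\{H_{\dim}(\phi,F)\mid F\leq V,\ \dim F<\infty\}$, where $H_{\dim}(\phi,F)=\lim_{n\to\infty}\frac1n\dim T_n(\phi,F)$. *)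

(* Defs.v *)
From HB Require Import structures.
From mathcomp Require Import all_boot all_order all_algebra.
From mathcomp Require Import all_classical all_reals all_analysis.

Set Implicit Arguments.
Unset Strict Implicit.
Unset Printing Implicit Defensive.

Import Order.TTheory GRing.Theory Num.Theory.

Local Open Scope classical_set_scope.
Local Open Scope ring_scope.

(* A topological vector space over the field K endowed with the discrete
   topology. The library's [TopologicalLmodule] requires scalars that are a
   [numDomainType] carrying the topology of its norm. An HB structure joining
   [TopologicalZmodule] and [GRing.Lmodule K] for an arbitrary field K is
   rejected because of that structure, hence the hand-made packaging. *)
Record topVectType (K : fieldType) := TopVect {
  topVect_zmod : topologicalZmodType;
  topVect_lmod : GRing.Zmodule_isLmodule K topVect_zmod;
  scale_discrete_continuous :
    continuous (fun z : discrete_topology K * topVect_zmod =>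
                  GRing.Zmodule_isLmodule.scale topVect_lmod z.1 z.2)
}.

Definition topVect_sort (K : fieldType) (V : topVectType K) : Type :=
  topVect_zmod V.
Coercion topVect_sort : topVectType >-> Sortclass.

HB.instance Definition _ (K : fieldType) (V : topVectType K) :=
  TopologicalZmodule.on (topVect_sort V).
HB.instance Definition _ (K : fieldType) (V : topVectType K) :=
  (topVect_lmod V : GRing.Zmodule_isLmodule K (topVect_sort V)).

Section LinearAlgebra.
Variables (R : realType) (K : fieldType) (V : lmodType K).
Implicit Types (U W F : set V) (phi : {linear V -> V}).

Definition linear_subspace W := GRing.submod_closed [in W].

Definition variety (v : V) W : set V := [set v + w | w in W].

(* The classes modulo U of v_0, ..., v_(n-1) form a basis of W / U. *)
Definition quotient_basis W U n (v : 'I_n -> V) :=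
  [/\ forall i, W (v i),
      forall w, W w -> exists c : 'I_n -> K, U (w - \sum_(i < n) c i *: v i)
    & forall c : 'I_n -> K, U (\sum_(i < n) c i *: v i) -> forall i, c i = 0].

(* For subspaces U `<=` W, all finite bases of W / U have the same length, so
   the infimum is over at most one value; it is +oo if there is none. *)
Definition dim_quotient W U : \bar R :=
  ereal_inf [set n%:R%:E | n in
               [set n : nat | exists v : 'I_n -> V, quotient_basis W U v]].

Definition dim W : \bar R := dim_quotient W [set 0].

Definition trajectory phi F (n : nat) : set V :=
  [set \sum_(i < n) iter i phi (x i) | x in
     [set x : 'I_n -> V | forall i, F (x i)]].

Definition Hdim phi F : \bar R :=
  limn (fun n => (n.+1%:R^-1)%:E * dim (trajectory phi F n.+1))%E.

Definition ent_dim phi : \bar R :=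
  ereal_sup [set Hdim phi F | F in
               [set F | linear_subspace F /\ (dim F < +oo)%E]].

End LinearAlgebra.

Section LocallyLinearlyCompact.
Variables (R : realType) (K : fieldType) (V : topVectType K).
Implicit Types (phi : {linear V -> V}).

Definition linearly_topologized :=
  hausdorff_space V /\
  forall N : set V, nbhs 0 N ->
    exists W : set V, [/\ linear_subspace W, nbhs 0 W & W `<=` N].

(* U is linearly compact for its subspace topology. *)
Definition linearly_compact (U : set V) :=
  forall C : set (set V),
    (forall A, C A -> exists (u : V) (W : set V),
       [/\ U u, linear_subspace W, W `<=` U, closed (W : set (subspace U))
         & A = variety u W]) ->
    finI C id -> \bigcap_(A in C) A !=set0.

Definition lin_compact_open : set (set V) :=
  [set U : set V | [/\ linear_subspace U, open U & linearly_compact U]].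

Definition locally_linearly_compact :=
  linearly_topologized /\ lin_compact_open !=set0.

Definition Hent phi (U : set V) : \bar R :=
  limn (fun n => (n.+1%:R^-1)%:E *
                 dim_quotient R (trajectory phi U n.+1) U)%E.

Definition ent phi : \bar R :=
  ereal_sup [set Hent phi U | U in lin_compact_open].

Lemma linearly_compact0 : linearly_compact [set 0].
Proof.
move=> C CA fC; exists 0 => A AC.
case: (CA _ AC) => u [W [-> lW W0 _ ->]].
exists 0; rewrite ?addr0 //; have [+ _] := lW; by rewrite inE.
Qed.

Lemma linear_subspace0 : linear_subspace ([set 0] : set V).
Proof.
split=> [|a u v]; rewrite !inE // => -> ->.
by rewrite scaler0 addr0.
Qed.

Lemma discrete_llc :
  (forall A : set V, open A) -> locally_linearly_compact.
Proof.
move=> opV; split; last first.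
  by exists [set 0]; split;
    [exact: linear_subspace0|exact: opV|exact: linearly_compact0].
split=> [x y /(_ [set x] [set y])|N N0].
  by case=> [||z [-> //]]; exact: open_nbhs_nbhs.
exists [set 0]; split; [exact: linear_subspace0| |].
  exact: open_nbhs_nbhs.
by move=> _ ->; exact: nbhs_singleton.
Qed.

End LocallyLinearlyCompact.

(* Main.v *)
(* In a discrete space every subspace is open and closed, and the linearly
   compact subspaces are the finite-dimensional ones. A linearly independent
   sequence v_0, v_1, ... in U yields the nested varieties
   v_0 + ... + v_(n-1) + <v_n, v_(n+1), ...>, whose intersection is empty.
   Conversely, in finite dimension, intersecting with a variety that is not
   contained in all members of the family drops the dimension. Hence both
   suprema range over the same U, for which dim (T_n / U) = dim T_n - dim U,
   and the constant dim U disappears after division by n. *)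
Require Import Defs.
From mathcomp Require Import all_boot all_order all_algebra finmap.
From mathcomp Require Import all_classical all_reals all_analysis.

Set Implicit Arguments.
Unset Strict Implicit.
Unset Printing Implicit Defensive.

Import Order.TTheory GRing.Theory Num.Theory.
Import numFieldNormedType.Exports.

Local Open Scope classical_set_scope.
Local Open Scope ring_scope.

(** * Closure properties of linear subspaces *)

Lemma subspace_0 (K : fieldType) (V : lmodType K) (W : set V) :
  linear_subspace W -> W 0.
Proof. by case=> + _; rewrite inE. Qed.

Lemma subspace_lincomb (K : fieldType) (V : lmodType K) (W : set V) a u v :
  linear_subspace W -> W u -> W v -> W (a *: u + v).
Proof. by case=> _ /(_ a u v) + Wu Wv; rewrite !inE; exact. Qed.

Lemma subspace_Z (K : fieldType) (V : lmodType K) (W : set V) a u :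
  linear_subspace W -> W u -> W (a *: u).
Proof.
by move=> lW Wu; rewrite -[_ *: _]addr0; apply: subspace_lincomb (subspace_0 lW).
Qed.

Lemma subspace_D (K : fieldType) (V : lmodType K) (W : set V) u v :
  linear_subspace W -> W u -> W v -> W (u + v).
Proof. by move=> lW Wu Wv; rewrite -[u]scale1r; exact: subspace_lincomb. Qed.

Lemma subspace_B (K : fieldType) (V : lmodType K) (W : set V) u v :
  linear_subspace W -> W u -> W v -> W (u - v).
Proof.
by move=> lW Wu Wv; rewrite addrC -scaleN1r; exact: subspace_lincomb.
Qed.

Lemma subspace_sum (K : fieldType) (V : lmodType K) (W : set V) n
    (c : 'I_n -> K) (v : 'I_n -> V) :
  linear_subspace W -> (forall i, W (v i)) -> W (\sum_(i < n) c i *: v i).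
Proof.
move=> lW Wv; elim/big_ind : _ => [|x y|i _]; first exact: subspace_0.
- exact: subspace_D.
- exact: subspace_Z.
Qed.

Lemma linear_subspace_set0 (K : fieldType) (V : lmodType K) :
  linear_subspace ([set 0] : set V).
Proof.
split=> [|a u v]; rewrite !inE // => -> ->.
by rewrite scaler0 addr0.
Qed.

Lemma linear_subspaceI (K : fieldType) (V : lmodType K) (W1 W2 : set V) :
  linear_subspace W1 -> linear_subspace W2 -> linear_subspace (W1 `&` W2).
Proof.
move=> l1 l2; split=> [|a u v]; rewrite !inE; first by split; exact: subspace_0.
by move=> [? ?] [? ?]; split; exact: subspace_lincomb.
Qed.

(** * Independence, bases and dimension bounds modulo a subspace *)

Definition independent_mod (K : fieldType) (V : lmodType K) (U : set V) n
    (v : 'I_n -> V) :=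
  forall c : 'I_n -> K, U (\sum_(i < n) c i *: v i) -> forall i, c i = 0.

(** The rows of [M] hold the coefficients of the [v i] in the [w j] modulo [U]. A row vector killed
    by [M] gives a combination of the [v i] lying in [U], hence is zero; so [M] is row free and has
    at most as many rows as columns. *)
Lemma independent_mod_leq (K : fieldType) (V : lmodType K) (U : set V) n m
    (v : 'I_n -> V) (w : 'I_m -> V) :
  linear_subspace U -> independent_mod U v ->
  (forall i, exists c : 'I_m -> K, U (v i - \sum_(j < m) c j *: w j)) ->
  (n <= m)%N.
Proof.
move=> lU vfree /choice[A vA].
pose M := \matrix_(i, j) A i j.
suff /eqP <- : row_free M by exact: rank_leq_col.
apply: inj_row_free => u uM0; apply/rowP => i; rewrite mxE.
apply: (vfree (fun i => u 0 i)) i.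
have -> : \sum_(i < n) u 0 i *: v i =
    \sum_(i < n) u 0 i *: (v i - \sum_(j < m) A i j *: w j).
  under [RHS]eq_bigr do rewrite scalerBr.
  rewrite sumrB [X in _ - X](_ : _ = 0) ?subr0//.
  under eq_bigr do rewrite scaler_sumr.
  rewrite /= exchange_big big1// => j _.
  move/rowP/(_ j): uM0; rewrite !mxE => uM0.
  under eq_bigr do rewrite scalerA.
  rewrite -scaler_suml -[RHS](scale0r (w j)); congr (_ *: _).
  by rewrite -[RHS]uM0; apply: eq_bigr => i _; rewrite mxE.
by apply: subspace_sum => // i; exact: vA.
Qed.

Definition cons_family (T : Type) n (x : T) (v : 'I_n -> T) : 'I_n.+1 -> T :=
  fun i => if unlift ord0 i is Some j then v j else x.

Lemma big_cons_family (K : fieldType) (V : lmodType K) n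
    (c : 'I_n.+1 -> K) (x : V) (v : 'I_n -> V) :
  \sum_(i < n.+1) c i *: cons_family x v i =
  c ord0 *: x + \sum_(i < n) c (lift ord0 i) *: v i.
Proof.
rewrite big_ord_recl /cons_family unlift_none; congr (_ + _).
by apply: eq_bigr => i _; rewrite liftK.
Qed.

Lemma independent_mod_cons (K : fieldType) (V : lmodType K) (U : set V) n
    (x : V) (v : 'I_n -> V) :
  linear_subspace U -> independent_mod U v ->
  ~ (exists c : 'I_n -> K, U (x - \sum_(i < n) c i *: v i)) ->
  independent_mod U (cons_family x v).
Proof.
move=> lU vfree xv c; rewrite big_cons_family => Uc.
(* Otherwise dividing by [c ord0] writes [x] modulo [U] as a combination of the [v i]. *)
have c0 : c ord0 = 0.
  apply/eqP/negPn/negP => c0; apply: xv.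
  exists (fun i => - ((c ord0)^-1 * c (lift ord0 i))).
  rewrite -sumrN; under eq_bigr do rewrite scaleNr opprK -scalerA.
  rewrite -scaler_sumr -[x in x + _](scalerK c0) -scalerDr.
  exact: subspace_Z.
move: Uc; rewrite c0 scale0r add0r => /vfree c1 i.
by case: (unliftP ord0 i) => [j ->|->].
Qed.

(** A bound on the dimension of [W / U] that presupposes no basis: it yields one by maximality and
    later serves as an induction measure. *)
Definition dim_le (K : fieldType) (V : lmodType K) (W U : set V) n :=
  forall m (v : 'I_m -> V), (forall i, W (v i)) -> independent_mod U v ->
  (m <= n)%N.

Lemma quotient_basis_dim_le (K : fieldType) (V : lmodType K) (W U : set V) n
    (v : 'I_n -> V) :
  linear_subspace U ->
  (forall w, W w -> exists c : 'I_n -> K, U (w - \sum_(i < n) c i *: v i)) ->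
  dim_le W U n.
Proof.
move=> lU vspan m w Ww wfree; apply: independent_mod_leq wfree _ => // i.
exact: vspan.
Qed.

(* A maximal independent family spans. *)
Lemma dim_le_quotient_basis (K : fieldType) (V : lmodType K) (W U : set V) n :
  linear_subspace U -> dim_le W U n ->
  exists m (v : 'I_m -> V), quotient_basis W U v.
Proof.
move=> lU Wn.
pose P m :=
  `[< exists v : 'I_m -> V, (forall i, W (v i)) /\ independent_mod U v >].
have P0 : P 0%N.
  apply/asboolP; exists (fun i => 0); split; by [case | move=> c _; case].
have Pn m : P m -> (m <= n)%N by move=> /asboolP[v [Wv vfree]]; exact: Wn vfree.
have exP : exists m, P m by exists 0%N.
case: (ex_maxnP exP Pn) => m /asboolP[v [Wv vfree]] mmax.
exists m, v; split=> // w Ww; apply: contrapT => wv.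
suff /mmax : P m.+1 by rewrite ltnn.
apply/asboolP; exists (cons_family w v); split; last exact: independent_mod_cons.
by move=> i; rewrite /cons_family; case: unliftP.
Qed.

(** Adjoining [x] to an independent family of [W'] gives a longer independent family of [W]. *)
Lemma dim_le_proper (K : fieldType) (V : lmodType K) (W W' : set V) x n :
  linear_subspace W' -> W' `<=` W -> W x -> ~ W' x ->
  dim_le W [set 0] n -> exists2 m, (m < n)%N & dim_le W' [set 0] m.
Proof.
move=> lW' W'W Wx W'x Wn.
have ltn m (v : 'I_m -> V) :
    (forall i, W' (v i)) -> independent_mod [set 0] v -> (m < n)%N.
  move=> W'v vfree; apply: (Wn _ (cons_family x v)).
    by move=> i; rewrite /cons_family; case: unliftP => // *; exact: W'W.
  apply: independent_mod_cons => //; first exact: linear_subspace_set0.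
  move=> [c /subr0_eq xE]; apply: W'x; rewrite xE.
  exact: subspace_sum.
(* The empty family already forces this, so [n.-1] is a genuine predecessor. *)
have n0 : (0 < n)%N.
  by apply: (ltn 0%N (fun=> 0)); [case | move=> c _; case].
exists n.-1; first by rewrite prednK.
by move=> m v W'v vfree; rewrite -ltnS prednK//; exact: ltn vfree.
Qed.

Lemma dim_quotientE (R : realType) (K : fieldType) (V : lmodType K)
    (W U : set V) n (v : 'I_n -> V) :
  linear_subspace U -> quotient_basis W U v -> dim_quotient R W U = n%:R%:E.
Proof.
move=> lU vb; rewrite /dim_quotient (_ : mkset _ = [set n]).
  by rewrite image_set1 ereal_inf1.
have le k l (u : 'I_k -> V) (w : 'I_l -> V) :
    quotient_basis W U u -> quotient_basis W U w -> (k <= l)%N.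
  by move=> [Wu _ ufree] [_ wspan _]; exact: (quotient_basis_dim_le lU wspan) ufree.
apply/seteqP; split=> [m [w wb]|_ ->]; last by exists v.
by apply/eqP; rewrite eqn_leq (le _ _ w v)//= (le _ _ v w).
Qed.

(** * Additivity of dimension *)

Definition cat_family (T : Type) k n (u : 'I_k -> T) (v : 'I_n -> T)
    : 'I_(k + n) -> T :=
  fun i => match fintype.split i with inl j => u j | inr j => v j end.

Lemma cat_family_lshift (T : Type) k n (u : 'I_k -> T) (v : 'I_n -> T) i :
  cat_family u v (lshift n i) = u i.
Proof. by rewrite /cat_family -[lshift n i]/(unsplit (inl i)) unsplitK. Qed.

Lemma cat_family_rshift (T : Type) k n (u : 'I_k -> T) (v : 'I_n -> T) i :
  cat_family u v (rshift k i) = v i.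
Proof. by rewrite /cat_family -[rshift k i]/(unsplit (inr i)) unsplitK. Qed.

Lemma big_cat_family (K : fieldType) (V : lmodType K) k n
    (c : 'I_(k + n) -> K) (u : 'I_k -> V) (v : 'I_n -> V) :
  \sum_i c i *: cat_family u v i =
  \sum_i c (lshift n i) *: u i + \sum_i c (rshift k i) *: v i.
Proof.
rewrite big_split_ord; congr (_ + _); apply: eq_bigr => i _.
  by rewrite cat_family_lshift.
by rewrite cat_family_rshift.
Qed.

Lemma lincomb_cat_family (K : fieldType) (V : lmodType K) k n
    (c : 'I_k -> K) (d : 'I_n -> K) (u : 'I_k -> V) (v : 'I_n -> V) :
  \sum_i cat_family c d i *: cat_family u v i =
  \sum_i c i *: u i + \sum_i d i *: v i.
Proof.
rewrite big_cat_family; congr (_ + _); apply: eq_bigr => i _.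
  by rewrite cat_family_lshift.
by rewrite cat_family_rshift.
Qed.

(** Spanning: subtract a combination of [v] to land in [U], then use [u]. Independence: in a
    vanishing combination the [v] part lies in [U], so its coefficients vanish first, then those of
    [u]. *)
Lemma quotient_basis_cat (K : fieldType) (V : lmodType K) (W U : set V) k n
    (u : 'I_k -> V) (v : 'I_n -> V) :
  linear_subspace U -> U `<=` W ->
  quotient_basis U [set 0] u -> quotient_basis W U v ->
  quotient_basis W [set 0] (cat_family u v).
Proof.
move=> lU UW [Uu uspan ufree] [Wv vspan vfree]; split=> [i|w Ww|c].
- by rewrite /cat_family; case: fintype.split => j //; exact: UW.
- have [d Ud] := vspan _ Ww; have [c /subr0_eq cE] := uspan _ Ud.
  by exists (cat_family c d); rewrite lincomb_cat_family -cE subrK subrr.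
- rewrite big_cat_family => sum0.
  have cr : forall i, c (rshift k i) = 0.
    apply: vfree; move/eqP: sum0; rewrite addrC addr_eq0 => /eqP ->.
    by rewrite -scaleN1r; apply: subspace_Z => //; exact: subspace_sum.
  have cl : forall i, c (lshift n i) = 0.
    apply: ufree; rewrite /= -[RHS]sum0 [X in _ + X]big1 ?addr0// => i _.
    by rewrite cr scale0r.
  by move=> i; case: (split_ordP i) => j ->.
Qed.

(** * Trajectories of finite-dimensional subspaces *)

Definition fin_dim (K : fieldType) (V : lmodType K) (W : set V) :=
  exists n (v : 'I_n -> V), quotient_basis W [set 0] v.

Lemma fin_dim_trajectory (K : fieldType) (V : lmodType K)
    (phi : {linear V -> V}) (F : set V) n :
  fin_dim F -> fin_dim (trajectory phi F n).
Proof.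
move=> [k [u [_ uspan _]]].
(* Only a spanning family is carried through the induction, since the vectors [phi^n (u i)] added at
   each stage may be dependent on the earlier ones. *)
suff [m [w wspan]] : exists m (w : 'I_m -> V),
    forall x, trajectory phi F n x -> exists c : 'I_m -> K, x = \sum_i c i *: w i.
  apply: (@dim_le_quotient_basis _ _ _ _ m); first exact: linear_subspace_set0.
  apply: (quotient_basis_dim_le (v := w)); first exact: linear_subspace_set0.
  by move=> x /wspan[c ->]; exists c; rewrite subrr.
elim: n => [|n [m [w wspan]]].
  exists 0%N, (fun=> 0) => _ [x _ <-]; exists (fun=> 0).
  by rewrite !big_ord0.
exists (m + k)%N, (cat_family w (iter n phi \o u)) => _ [x Fx <-].
rewrite big_ord_recr/=.
have /wspan[c ->] : trajectory phi F n
    (\sum_(i < n) iter i phi (x (widen_ord (leqnSn n) i))).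
  by exists (fun i => x (widen_ord (leqnSn n) i)).
have [d /subr0_eq ->] := uspan _ (Fx ord_max).
exists (cat_family c d); rewrite lincomb_cat_family; congr (_ + _).
elim: n {wspan w x Fx} => //= n ->.
by rewrite linear_sum; apply: eq_bigr => i _; rewrite linearZ.
Qed.

(** Put [x] in the slot of the zeroth power and 0 elsewhere; the length [n.+1] ensures that this
    slot exists. *)
Lemma sub_trajectory (K : fieldType) (V : lmodType K)
    (phi : {linear V -> V}) (F : set V) n :
  linear_subspace F -> F `<=` trajectory phi F n.+1.
Proof.
move=> lF x Fx; exists (fun i => if i == ord0 then x else 0).
  by move=> i; case: ifP => // _; exact: subspace_0.
have iter0 m : iter m phi 0 = 0 by elim: m => //= m ->; exact: raddf0.
by rewrite big_ord_recl/= big1 ?addr0// => i _; rewrite iter0 raddf0.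
Qed.

(** Expressing both dimensions through one natural number [m] avoids subtraction in the extended
    reals. *)
Lemma dim_trajectoryD (R : realType) (K : fieldType) (V : lmodType K)
    (phi : {linear V -> V}) (F : set V) k (u : 'I_k -> V) n :
  linear_subspace F -> quotient_basis F [set 0] u ->
  exists m, dim_quotient R (trajectory phi F n.+1) F = m%:R%:E /\
    Defs.dim R (trajectory phi F n.+1) = (k + m)%:R%:E.
Proof.
move=> lF ub; have [] := @fin_dim_trajectory _ _ phi F n.+1; first by exists k, u.
move=> l [w [_ wspan _]].
have [|m [v vb]] := @dim_le_quotient_basis _ _ (trajectory phi F n.+1) F l lF.
  apply: (quotient_basis_dim_le (v := w)) => // x /wspan[c cx].
  by exists c; rewrite cx; exact: subspace_0.
exists m; split; first exact: dim_quotientE vb.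
apply: dim_quotientE; first exact: linear_subspace_set0.
by apply: quotient_basis_cat ub vb => //; exact: sub_trajectory.
Qed.

(** * Passage to the limit *)

(* Both sequences have the same set of limits, so neither needs to converge. *)
Lemma lim_adde_cvg0 (R : realType) (f h : nat -> \bar R) (r : nat -> R) :
  (forall n, h n = (f n + (r n)%:E)%E) -> r @ \oo --> (0 : R) ->
  limn f = limn h.
Proof.
move=> hE r0; rewrite /lim /lim_in; congr (get _).
apply/funext => l; apply/propext.
have re0 : (fun n => (r n)%:E) @ \oo --> (0%R)%:E by apply: cvg_EFin => //; exact: nearW.
have reN0 : (fun n => (- r n)%:E) @ \oo --> (0%R)%:E.
  by apply: cvg_EFin; [exact: nearW|rewrite -oppr0; exact: cvgN].
(* The limit [l] may be infinite, but the limit added to it is the finite number 0, so the sum is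
   defined. *)
split=> fl.
- rewrite -[l]adde0 (_ : h = fun n => (f n + (r n)%:E)%E); last exact/funext.
  by apply: cvgeD => //; exact: fin_num_adde_defl.
- rewrite -[l]adde0 (_ : f = fun n => (h n + (- r n)%:E)%E).
    by apply: cvgeD => //; exact: fin_num_adde_defl.
  by apply/funext => n; rewrite hE EFinN addeK.
Qed.

(** By additivity the two sequences differ by [k / (n + 1)], with [k] the dimension of [F]. *)
Lemma Hent_Hdim (R : realType) (K : fieldType) (V : topVectType K)
    (phi : {linear V -> V}) (F : set V) :
  linear_subspace F -> fin_dim F -> Hent R phi F = Hdim R phi F.
Proof.
move=> lF [k [u ub]]; rewrite /Hent /Hdim.
apply: (lim_adde_cvg0 (r := fun n => n.+1%:R^-1 * k%:R)).
  move=> n; have [m [-> ->]] := dim_trajectoryD R phi n lF ub.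
  by rewrite -!EFinM -EFinD natrD mulrDr addrC.
rewrite -(mul0r k%:R); apply: cvgM; last exact: cvg_cst.
exact: cvg_harmonic.
Qed.

(** * Finite-dimensional subspaces are linearly compact *)

Lemma discrete_closed (T : topologicalType) :
  (forall A : set T, open A) -> forall A : set T, closed A.
Proof. by move=> opT A; rewrite -[A]setCK; exact: open_closedC. Qed.

(** Strong induction on [n]. The variety [u + W] is kept apart from [C] so that it can be replaced
    by its intersection with a member of [C], whose direction is smaller. *)
Lemma variety_meet_family (K : fieldType) (V : lmodType K) n (u : V) (W : set V)
    (C : set (set V)) :
  linear_subspace W -> dim_le W [set 0] n ->
  (forall A, C A -> exists v W', linear_subspace W' /\ A = variety v W') ->
  (forall D, finite_set D -> D `<=` C ->
     (variety u W `&` \bigcap_(A in D) A) !=set0) ->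
  (variety u W `&` \bigcap_(A in C) A) !=set0.
Proof.
move=> + + Cvar; elim/ltn_ind: n u W => n IH u W lW Wn CW.
have [uC|/existsNP[A /not_implyP[CA uA]]] :=
  pselect (forall A, C A -> variety u W `<=` A).
  exists u; split; first by exists 0; rewrite ?addr0//; exact: subspace_0.
  move=> A CA; apply: uC => //; exists 0; rewrite ?addr0//; exact: subspace_0.
have [v [W' [lW' AE]]] := Cvar _ CA.
(* A common point [x] of [u + W] and [A] becomes the base point of their intersection. *)
have [|x []] := CW [set A] (finite_set1 A); first by move=> _ ->.
rewrite bigcap_set1 {1}AE => -[w Ww wx] [w' W'w' w'x].
have BE : variety u W `&` A = variety x (W `&` W').
  rewrite AE; apply/seteqP; split=> y.
    move=> [[z Wz <-] [z' W'z' zz']]; exists (z - w); last by rewrite -wx addrACA subrr addr0.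
    split; first exact: subspace_B.
    have -> : z - w = z' - w'.
      have := congr2 (fun a b => a - b) zz' (etrans w'x (esym wx)).
      by rewrite opprD addrACA subrr add0r [in RHS]opprD [in RHS]addrACA subrr add0r.
    exact: subspace_B.
  move=> [z [Wz W'z] <-]; split.
    by exists (w + z); rewrite -?wx ?addrA//; exact: subspace_D.
  by exists (w' + z); rewrite -?w'x ?addrA//; exact: subspace_D.
(* If [W] were contained in [W'], the intersection would be all of [u + W], against the choice of
   [A]. *)
have [t Wt W't] : exists2 t, W t & ~ W' t.
  apply: contrapT => WW'; apply: uA => _ [z Wz <-].
  suff : (variety u W `&` A) (u + z) by case.
  rewrite BE; exists (z - w); last by rewrite -wx addrACA subrr addr0.
  have Wzw : W (z - w) by exact: subspace_B.
  split=> //; apply: contrapT => W'zw; apply: WW'; by exists (z - w).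
have WW'W : W `&` W' `<=` W by move=> z [].
have WW't : ~ (W `&` W') t by case.
have lWW' := linear_subspaceI lW lW'.
have [m mn WW'm] := dim_le_proper lWW' WW'W Wt WW't Wn.
have [//|//|D Dfin DC|y [xy DCy]] := IH m mn x (W `&` W').
  rewrite -BE -setIA -bigcap_setU1; apply: CW.
    by rewrite finite_setU; split.
  by move=> B [->|/DC].
by exists y; split=> //; move: xy; rewrite -BE => -[].
Qed.

Lemma fin_dim_linearly_compact (K : fieldType) (V : topVectType K) (U : set V) :
  linear_subspace U -> fin_dim U -> linearly_compact U.
Proof.
move=> lU [n [v [_ vspan _]]] C Cvar Cfin.
have U0 : variety 0 U = U.
  apply/seteqP; split=> [_ [u Uu <-]|u Uu]; first by rewrite add0r.
  by exists u; rewrite ?add0r.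
have Un := quotient_basis_dim_le (@linear_subspace_set0 _ V) vspan.
have [||x []] := @variety_meet_family _ V n 0 U C lU Un; last by exists x.
  by move=> A /Cvar[u [W [_ lW _ _ ->]]]; exists u, W.
move=> D Dfin DC.
(* An empty [D] has the whole space as intersection, so a point of [U] is supplied by hand;
   otherwise any member of [D] places the common point in [U]. *)
have [->|/set0P[A DA]] := eqVneq D set0.
  by rewrite bigcap_set0 setIT U0; exists 0; exact: subspace_0.
have [|x] := Cfin (fset_set D).
  by move=> B; rewrite in_fset_set// !inE => /DC.
rewrite fset_setK// => Dx; exists x; split=> //; rewrite U0.
have [u [W [Uu lW WU _ AE]]] := Cvar _ (DC _ DA).
have := Dx _ DA; rewrite /= AE => -[w Ww <-].
by apply: subspace_D => //; exact: WU.
Qed.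

(** * Linearly compact subspaces of a discrete space are finite-dimensional *)

Lemma infinite_free_sequence (K : fieldType) (V : lmodType K) (U : set V) :
  ~ fin_dim U ->
  exists v : nat -> V, (forall i, U (v i)) /\
    forall n (c : nat -> K), \sum_(i < n) c i *: v i = 0 ->
    forall i, (i < n)%N -> c i = 0.
Proof.
move=> Uinf.
(* No finite list spans [U], so [f] picks a vector of [U] outside the span of a given list;
   iterating [f] builds the sequence. *)
have /choice[f fP] : forall s : seq V, exists x, U x /\
    ~ exists c : 'I_(size s) -> K, x = \sum_i c i *: s`_i.
  move=> s; apply: contrapT => sU; apply: Uinf.
  apply: (@dim_le_quotient_basis _ _ _ _ (size s)).
    exact: linear_subspace_set0.
  apply: (quotient_basis_dim_le (v := fun i => s`_i)).
    exact: linear_subspace_set0.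
  move=> x Ux; apply: contrapT => xs; apply: sU; exists x; split=> // -[c xE].
  by apply: xs; exists c; rewrite /= xE subrr.
pose s n := iter n (fun t => rcons t (f t)) [::].
have sS n : s n.+1 = rcons (s n) (f (s n)) by [].
have size_s n : size (s n) = n.
  by elim: n => // n IH; rewrite sS size_rcons IH.
have nth_s n i : (i < n)%N -> (s n)`_i = f (s i).
  elim: n => // n IH; rewrite ltnS sS nth_rcons size_s leq_eqVlt.
  by case: eqVneq => [->|] /=; rewrite ?ltnn// => _ ltin; rewrite ltin IH.
exists (f \o s); split=> [i|n c]; first by have [] := fP (s i).
elim: n => // n IH; rewrite big_ord_recr/= => sum0.
have cn0 : c n = 0.
  apply/eqP/negPn/negP => cn; have [_ []] := fP (s n).
  exists (fun i => - ((c n)^-1 * c i)).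
  have := congr1 (fun x => (c n)^-1 *: x) sum0.
  rewrite scaler0 scalerDr scalerK// addrC => /eqP; rewrite addr_eq0 => /eqP ->.
  rewrite scaler_sumr -sumrN size_s; apply: eq_bigr => i _.
  by rewrite nth_s//= scaleNr scalerA.
move: sum0; rewrite cn0 scale0r addr0 => /IH c0 i.
by rewrite ltnS leq_eqVlt => /predU1P[->|/c0].
Qed.

Lemma linearly_compact_fin_dim (K : fieldType) (V : topVectType K) (U : set V) :
  (forall A : set V, open A) -> linear_subspace U -> linearly_compact U ->
  fin_dim U.
Proof.
move=> V_discrete lU Uc; apply: contrapT => /infinite_free_sequence[v [Uv vfree]].
pose S n (c : nat -> K) := \sum_(i < n) c i *: v i.
(* The span of [v n], [v n.+1], ...; here [m] bounds the support of the coefficients. *)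
pose W n := [set x | exists m (c : nat -> K),
  [/\ forall i, (i < n)%N -> c i = 0, forall i, (m <= i)%N -> c i = 0
    & x = S m c]].
have widenS m p c : (m <= p)%N -> (forall i, (m <= i)%N -> c i = 0) ->
    S m c = S p c.
  move=> mp c0; rewrite /S (big_ord_widen p (fun i => c i *: v i))//.
  rewrite big_mkcond/=; apply: eq_bigr => i _.
  by case: ltnP => // /c0 ->; rewrite scale0r.
have SD m a c d : S m (fun i => a * c i + d i) = a *: S m c + S m d.
  rewrite /S scaler_sumr -big_split; apply: eq_bigr => i _.
  by rewrite scalerDl scalerA.
have lW n : linear_subspace (W n).
  split=> [|a x z]; rewrite !inE.
    by exists 0%N, (fun=> 0); rewrite /S big_ord0.
  move=> [m [c [cn cm ->]]] [p [d [dn dp ->]]].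
  exists (maxn m p), (fun i => a * c i + d i); split.
  - by move=> i ni; rewrite cn// dn// mulr0 addr0.
  - by move=> i; rewrite geq_max => /andP[mi pi]; rewrite cm// dp// mulr0 addr0.
  - by rewrite SD (@widenS m (maxn m p))// ?leq_maxl// (@widenS p (maxn m p))// leq_maxr.
have WU n : W n `<=` U.
  by move=> _ [m [c [_ _ ->]]]; exact: subspace_sum.
pose s n := \sum_(i < n) v i.
have sE n : s n = S n (fun i => (i < n)%:R).
  by apply: eq_bigr => i _; rewrite ltn_ord scale1r.
pose A n := variety (s n) (W n).
(* This gives the finite intersection property: the partial sum at the largest index lies in every
   member of a finite subfamily. *)
have sA n p : (n <= p)%N -> A n (s p).
  move=> np; exists (s p - s n); last by rewrite addrC subrK.
  exists p, (fun i => (i < p)%:R - (i < n)%:R); split=> [i ni|i pi|].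
  - by rewrite ni (leq_trans ni np) subrr.
  - by rewrite !ltnNge pi (leq_trans np pi) subrr.
  - rewrite !sE (@widenS n p)// => [|i ni]; last by rewrite ltnNge ni.
    rewrite addrC -scaleN1r -SD; apply: eq_bigr => i _.
    by rewrite mulN1r addrC.
have [||y Ay] := Uc (range A).
- move=> _ [n _ <-]; exists (s n), (W n); split=> //.
    rewrite /s; elim/big_ind : _ => //; first exact: subspace_0.
    by move=> x z; exact: subspace_D.
  by apply: closed_subspaceW; exact: discrete_closed.
- move=> D DA.
  have kex : forall B : set V, exists n, B \in D -> B = A n.
    move=> B; have [/DA|_] := boolP (B \in D); last by exists 0%N.
    by rewrite inE => -[n _ <-]; exists n.
  have [k kP] := choice kex.
  exists (s (\max_(B <- finmap.enum_fset D) k B)) => B /= BD.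
  rewrite [B]kP//; apply: sA; exact: leq_bigmax_seq.
(* Membership of [y] in [A 0] gives an expansion without [v m], whereas [A m.+1] gives one in which
   [v m] has coefficient 1. Their difference, padded to length [M], contradicts freeness. *)
have [_ [m [c [_ cm ->]]] yE] := Ay _ (imageT A 0%N).
have [_ [p [d [dm dp ->]]] yE'] := Ay _ (imageT A m.+1).
pose M := maxn m.+1 p.
have mM : (m < M)%N by rewrite leq_maxl.
have := vfree M (fun i => -1 * c i + ((i < m.+1)%:R + d i)).
have -> : \sum_(i < M) (-1 * c i + ((i < m.+1)%:R + d i)) *: v i = 0.
  rewrite -/(S M (fun i => -1 * c i + ((i < m.+1)%:R + d i))) SD.
  rewrite (_ : (fun i => _ + d i) = (fun i => 1 * (i < m.+1)%:R + d i)); last first.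
    by apply/funext => i; rewrite mul1r.
  rewrite SD scale1r scaleN1r -(widenS m M c (ltnW mM) cm).
  rewrite -(widenS p M d (leq_maxr _ _) dp).
  rewrite -(widenS m.+1 M (fun i => (i < m.+1)%:R)) ?leq_maxl//.
    by rewrite -sE yE' -yE /s big_ord0 add0r addrC subrr.
  by move=> i mi; rewrite ltnNge mi.
move=> /(_ erefl m mM)/eqP.
by rewrite cm// dm// ltnSn mulr0 add0r addr0 oner_eq0.
Qed.

(** * Equality of the two entropies *)

Lemma fin_dim_ltey (R : realType) (K : fieldType) (V : lmodType K) (F : set V) :
  fin_dim F <-> (Defs.dim R F < +oo)%E.
Proof.
split=> [[n [v vb]]|].
  by rewrite /Defs.dim (dim_quotientE R (@linear_subspace_set0 _ V) vb) ltry.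
rewrite /Defs.dim /dim_quotient => Fy.
(* Without a finite basis the infimum is over the empty set, hence [+oo]. *)
apply: contrapT => Finf; move: Fy; rewrite (_ : mkset _ = set0).
  by rewrite image_set0 ereal_inf0 ltxx.
by apply/seteqP; split=> // n [v vb]; apply: Finf; exists n, v.
Qed.

Theorem lemma3p2 (R : realType) (K : fieldType) (V : topVectType K)
    (V_discrete : forall A : set V, open A) (phi : {linear V -> V}) :
  ent R phi = ent_dim R phi.
Proof.
rewrite /ent /ent_dim; congr ereal_sup.
(* In both inclusions the same subspace serves as witness. *)
apply/seteqP; split=> [_ [U [lU _ Uc] <-]|_ [F [lF /fin_dim_ltey Ffin] <-]].
  have Ufin := linearly_compact_fin_dim V_discrete lU Uc.
  by exists U; [split=> //; exact/fin_dim_ltey|rewrite Hent_Hdim].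
exists F; last exact: Hent_Hdim.
by split=> //; exact: fin_dim_linearly_compact.
Qed.
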